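(* Let $p=2$, $k=\mathbb{F}_2$, and let $G$ be a finite group. A cohomology class $[\zeta]\in\hat H^n(G)$ is productive if and only if $\mathrm{P}_1(\zeta)\in\hat H^{2n-1}(G)$ is divisible by $\zeta$ in $\hat H^*(G)$.
   Context: Let $\zeta:\Omega^nk\to k$ be a surjective $kG$-linear map representing $[\zeta]\in\hat H^n(G)=\underline{\mathrm{Hom}}_{kG}(\Omega^nk,k)$ (stable homomorphisms, i.e. modulo maps factoring through projectives), and let $L_\zeta$ be its kernel. The class $[\zeta]$ is called productive if $\zeta\otimes\mathrm{id}_{L_\zeta}:\Omega^nk\otimes L_\zeta\to L_\zeta$ is stably zero (factors through a projective module). The operation is $\mathrm{P}_1(\zeta)=Q_{1-n}([\zeta])$ for $[\zeta]\in\hat H^n(G)$. Operations $Q_s$ on $\hat H^*(G)$ for $p=2$: let $P$ be a complete projective resolution of $k$ by finitely generated right $kG$-modules: an exact complex $\cdots\leftarrow P_{-1}\leftarrow P_0\leftarrow P_1\leftarrow\cdots$ of projectives with $\varepsilon:P_0\to k$ a cokernel of $P_1\to P_0$. Put $(P^{\boxtimes2})_n=\prod_{s+t=n}P_s\otimes P_t$ with the tensor differential, diagonal action, and $\Sigma_2$ acting by the twist. For complexes $X,Y$ of $kG$-modules, $\mathrm{Hom}^n(X,Y)=\prod_j\mathrm{Hom}_{kG}(X_{n+j},Y_j)$ with $df=\partial f+f\partial$; $\hat H^*(G)=H^*\mathrm{Hom}^*(P,k)$. Let $\mathcal C(2)\subseteq\mathrm{Hom}^*(P,P^{\boxtimes2})$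 be the subcomplex which is $0$ in positive degrees, consists of the cocycles in degree $0$, and in degrees $m<0$ consists of all $f$ whose components $P_i\to P_s\otimes P_t$ vanish whenever $i<0$ and $s,t\ge0$; it is augmented over $k$ by $f\mapsto c$ where $\varepsilon^{\boxtimes2}f=c\,\varepsilon$ (a quasi-isomorphism). Let $W$ be the standard free resolution of $k$ over $k\Sigma_2$ with one generator $e_i$ in each homological degree $i\ge0$ (cochain degree $-i$) and $de_i=(1+\tau)e_{i-1}$, and choose a $\Sigma_2$-equivariant chain map $\vartheta:W\to\mathcal C(2)$ over $\mathrm{id}_k$. For $x$ represented by a cocycle $a$, $Q_s(x)\in\hat H^{|x|-s}(G)$ is the class of $(a\boxtimes a)\circ\vartheta(e_{s+|x|})$ if $s+|x|\ge0$, and $Q_s(x)=0$ otherwise. *)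

(* Defs.v *)
From mathcomp Require Import all_boot all_order all_fingroup all_algebra.
From mathcomp Require Import mxrepresentation mxtens.

Set Implicit Arguments.
Unset Strict Implicit.
Unset Printing Implicit Defensive.

Import GRing.Theory.
Local Open Scope ring_scope.

(* A finitely generated right kG-module, k = 'F_2, is a matrix representation:
   g acts on a row vector v by v *m rM g, and a linear map f acts by v *m f.
   Hence composites are written in diagrammatic order.  As the characteristic
   is 2, no signs occur in differentials or in the twist. *)

Section Modules.

Variables (gT : finGroupType) (G : {group gT}).
Local Notation kGmod := (mx_representation 'F_2 G).

Definition kG_hom m n (rM : kGmod m) (rN : kGmod n) (f : 'M['F_2]_(m, n)) :=
  forall g, g \in G -> rM g *m f = f *m rN g.

Lemma triv_mx_repr : mx_repr G (fun _ : gT => 1%:M : 'M['F_2]_1).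
Proof. by split=> // x y _ _; rewrite mulmx1. Qed.

Definition triv_repr : kGmod 1 := MxRepresentation triv_mx_repr.

Lemma tens_mx_repr m n (rM : kGmod m) (rN : kGmod n) :
  mx_repr G (fun g => rM g *t rN g).
Proof.
split=> [|x y Gx Gy]; last by rewrite !repr_mxM // tensmx_mul.
rewrite !repr_mx1; apply/matrixP=> i j.
case: (mxtens_indexP i) => i1 i2; case: (mxtens_indexP j) => j1 j2.
by rewrite tensmxE !mxE (can_eq (@mxtens_indexK _ _)) xpair_eqE -natrM mulnb.
Qed.

Definition tens_repr m n (rM : kGmod m) (rN : kGmod n) : kGmod (m * n) :=
  MxRepresentation (tens_mx_repr rM rN).

(* Projective objects of the category of finitely generated kG-modules. *)
Definition projective m (rP : kGmod m) : Prop :=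
  forall n1 n2 (rM : kGmod n1) (rN : kGmod n2)
         (p : 'M['F_2]_(n1, n2)) (f : 'M['F_2]_(m, n2)),
    kG_hom rM rN p -> row_full p -> kG_hom rP rN f ->
  exists2 h : 'M['F_2]_(m, n1), kG_hom rP rM h & h *m p = f.

Definition stably_zero m n (rM : kGmod m) (rN : kGmod n)
    (f : 'M['F_2]_(m, n)) : Prop :=
  exists l (rP : kGmod l) (u : 'M['F_2]_(m, l)) (v : 'M['F_2]_(l, n)),
    [/\ projective rP, kG_hom rM rP u, kG_hom rP rN v & u *m v = f].

Definition is_cokernel l m n (rM : kGmod m) (rN : kGmod n)
    (f : 'M['F_2]_(l, m)) (q : 'M['F_2]_(m, n)) : Prop :=
  [/\ kG_hom rM rN q, row_full q & (kermx q == f)%MS].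

Definition is_kernel l m n (rL : kGmod l) (rM : kGmod m)
    (f : 'M['F_2]_(m, n)) (iota : 'M['F_2]_(l, m)) : Prop :=
  [/\ kG_hom rL rM iota, row_free iota & (iota == kermx f)%MS].

(* zeta (x) id : M (x) L -> k (x) L = L is stably zero; this is meant to be
   used for a surjective zeta : Omega^n k -> k and L = L_zeta its kernel. *)
Definition productive m l (rM : kGmod m) (rL : kGmod l)
    (zeta : 'M['F_2]_(m, 1)) : Prop :=
  stably_zero (tens_repr rM rL) rL
    (castmx (erefl _, mul1n l) (zeta *t (1%:M : 'M['F_2]_l))).

(* The differential P_i -> P_(i-1) is cr_d i (i - 1).  Giving cr_d two indices
   avoids casts between the dimensions at i and at (i - 1) + 1; all the other
   entries are zero. *)
Record complete_resolution := CompleteResolution {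
  cr_dim : int -> nat;
  cr_mod : forall i, kGmod (cr_dim i);
  cr_d : forall i j, 'M['F_2]_(cr_dim i, cr_dim j);
  cr_eps : 'M['F_2]_(cr_dim 0, 1);
  cr_d_deg : forall i j, i != j + 1 -> cr_d i j = 0;
  cr_d_hom : forall i j, kG_hom (cr_mod i) (cr_mod j) (cr_d i j);
  cr_proj : forall i, projective (cr_mod i);
  cr_exact : forall i, (cr_d (i + 1) i == kermx (cr_d i (i - 1)))%MS;
  cr_eps_coker : is_cokernel (cr_mod 0) triv_repr (cr_d 1 0) cr_eps
}.

End Modules.

(* The isomorphism k^m (x) k^n -> k^n (x) k^m exchanging the factors. *)
Definition swapmx m n : 'M['F_2]_(m * n, n * m) :=
  \matrix_(i, j) (((mxtens_unindex i).1 == (mxtens_unindex j).2) &&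
                  ((mxtens_unindex i).2 == (mxtens_unindex j).1))%:R.

Section TateCohomology.

Variables (gT : finGroupType) (G : {group gT}) (P : complete_resolution G).
Local Notation dimP := (cr_dim P).
Local Notation modP := (cr_mod P).
Local Notation d := (cr_d P).
Local Notation eps := (cr_eps P).

(* As k is concentrated in degree 0, Hom^n(P, k) = Hom_kG(P_n, k). *)
Definition tate_cocycle (n : int) (a : 'M['F_2]_(dimP n, 1)) : Prop :=
  kG_hom (modP n) (triv_repr G) a /\ d (n + 1) n *m a = 0.

Definition cohomologous (n : int) (a b : 'M['F_2]_(dimP n, 1)) : Prop :=
  exists2 c : 'M['F_2]_(dimP (n - 1), 1),
    kG_hom (modP (n - 1)) (triv_repr G) c & a - b = d n (n - 1) *m c.

(* Since (P^[x]2)_j is the product of the P_s (x) P_t with s + t = j, a map into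
   it is the family of its components: f i s t : P_i -> P_s (x) P_t.  A family of
   degree m lives on i = m + s + t and is extended by zero elsewhere. *)
Definition hom2 := forall i s t : int, 'M['F_2]_(dimP i, dimP s * dimP t).

Definition in_hom2 (m : int) (f : hom2) : Prop :=
  (forall i s t, i != m + s + t -> f i s t = 0) /\
  (forall i s t, kG_hom (modP i) (tens_repr (modP s) (modP t)) (f i s t)).

Definition delta2 (f : hom2) : hom2 := fun i s t =>
  f i (s + 1) t *m (d (s + 1) s *t (1%:M : 'M_(dimP t)))
  + f i s (t + 1) *m ((1%:M : 'M_(dimP s)) *t d (t + 1) t)
  + d i (i - 1) *m f (i - 1) s t.

Definition twist2 (f : hom2) : hom2 := fun i s t =>
  f i t s *m swapmx (dimP t) (dimP s).

(* The degree m part of the complex C(2). *)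
Definition in_C2 (m : int) (f : hom2) : Prop :=
  [/\ in_hom2 m f,
      0 < m -> forall i s t, f i s t = 0,
      m = 0 -> forall i s t, delta2 f i s t = 0
    & m < 0 -> forall i s t, i < 0 -> 0 <= s -> 0 <= t -> f i s t = 0].

(* eps (x) eps vanishes outside P_0 (x) P_0. *)
Definition augments_to (f : hom2) (c : 'F_2) : Prop :=
  f 0 0 0 *m (eps *t eps) = c *: eps.

(* A Sigma_2-equivariant chain map W -> C(2) over id_k, given by the images
   theta j of the free generators e_j; the relation d theta(e_0) = 0 is part of
   in_C2 in degree 0. *)
Definition is_theta (theta : nat -> hom2) : Prop :=
  [/\ forall j : nat, in_C2 (- j%:Z) (theta j),
      augments_to (theta 0%N) 1
    & forall (j : nat) i s t,
        delta2 (theta j.+1) i s t = theta j i s t + twist2 (theta j) i s t].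

(* A complete diagonal approximation P -> P^[x]2. *)
Definition is_diagonal (Delta : hom2) : Prop :=
  in_C2 0 Delta /\ augments_to Delta 1.

(* A cocycle representing Q_s of the class of a, in degree n - s; the map
   a [x] a is a (x) a on P_n (x) P_n and zero on all other factors. *)
Definition Qop (theta : nat -> hom2) (s n : int) (a : 'M['F_2]_(dimP n, 1)) :
    'M['F_2]_(dimP (n - s), 1) :=
  match s + n with
  | Posz m => theta m (n - s) n n *m (a *t a)
  | Negz _ => 0
  end.

(* In degree n - (1 - n) = 2n - 1. *)
Definition P1op (theta : nat -> hom2) (n : int) (a : 'M['F_2]_(dimP n, 1)) :=
  Qop theta (1 - n) a.

(* The degree r component of the product a b = (a [x] b) o Delta, which is zero
   unless r = p + q; keeping r as an argument avoids casts. *)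
Definition cup (Delta : hom2) (p q r : int)
    (a : 'M['F_2]_(dimP p, 1)) (b : 'M['F_2]_(dimP q, 1)) :
    'M['F_2]_(dimP r, 1) :=
  Delta r p q *m (a *t b).

Definition tate_divides (Delta : hom2) (n r : int)
    (a : 'M['F_2]_(dimP n, 1)) (x : 'M['F_2]_(dimP r, 1)) : Prop :=
  exists2 y : 'M['F_2]_(dimP (r - n), 1),
    tate_cocycle y & cohomologous x (cup Delta r a y).

End TateCohomology.

(* Main.v *)
Require Import Defs.
From mathcomp Require Import all_boot all_order all_fingroup all_algebra.
From mathcomp Require Import mxrepresentation mxtens.

(* Write M for Omega^n k.  The difference zeta (x) id - id (x) zeta on M (x) M takes
   values in L, and restricts to zeta (x) id_L on M (x) L; a diagram chase shows
   that zeta is productive iff this map b : M (x) M -> L is stably zero.  The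
   composite of b with the stable equivalence Omega^(2n) k -> M (x) M given by
   the diagonal theta e_0 is the image of P_1(zeta) under the connecting map of
   the triangle L -> M -> k, because theta e_1 is a homotopy from theta e_0 to
   its twist.  Hence b is stably zero iff P_1(zeta) is zeta composed with a map
   Omega^(2n-1) k -> M, that is, iff P_1(zeta) is divisible by zeta. *)

Set Implicit Arguments.
Unset Strict Implicit.
Unset Printing Implicit Defensive.

Import GRing.Theory.
Local Open Scope ring_scope.

Lemma addmm2 m n (A : 'M['F_2]_(m, n)) : A + A = 0.
Proof.
by apply/matrixP=> i j; rewrite !mxE; apply: addrr_pchar2; rewrite pchar_Fp.
Qed.

Lemma oppmm2 m n (A : 'M['F_2]_(m, n)) : - A = A.
Proof. by apply/eqP; rewrite eq_sym -addr_eq0 addmm2. Qed.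

(** * Tensor products of matrices *)

Section Tensor.

Variable F : fieldType.

Lemma tens1mx m n : (1%:M : 'M[F]_m) *t (1%:M : 'M[F]_n) = 1%:M.
Proof.
apply/matrixP=> i j; case: (mxtens_indexP i) => i1 i2.
case: (mxtens_indexP j) => j1 j2.
by rewrite tensmxE !mxE (can_eq (@mxtens_indexK _ _)) xpair_eqE -natrM mulnb.
Qed.

Lemma tensmxDl m n p q (A B : 'M[F]_(m, n)) (C : 'M[F]_(p, q)) :
  (A + B) *t C = A *t C + B *t C.
Proof. by apply/matrixP=> i j; rewrite !mxE mulrDl. Qed.

Lemma sum_mxtens m n (V : nmodType) (f : 'I_(m * n) -> V) :
  \sum_k f k = \sum_a \sum_b f (mxtens_index (a, b)).
Proof.
rewrite pair_bigA /= (reindex (@mxtens_index m n)) /=.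
  by apply: eq_bigr => -[].
exists (@mxtens_unindex m n) => x _; first exact: mxtens_indexK.
exact: mxtens_unindexK.
Qed.

(* The map f (x) c followed by N (x) k = N, respectively c (x) f followed by
   k (x) N = N. *)
Definition rten m n p (f : 'M[F]_(m, n)) (c : 'M[F]_(p, 1)) :
    'M[F]_(m * p, n) :=
  \matrix_(i, j) (f (mxtens_unindex i).1 j * c (mxtens_unindex i).2 0).

Definition lten m n p (c : 'M[F]_(p, 1)) (f : 'M[F]_(m, n)) :
    'M[F]_(p * m, n) :=
  \matrix_(i, j) (c (mxtens_unindex i).1 0 * f (mxtens_unindex i).2 j).

Lemma mul_tens_rten m n p m' p' (a : 'M[F]_(m', m)) (b : 'M[F]_(p', p))
    (f : 'M[F]_(m, n)) (c : 'M[F]_(p, 1)) :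
  (a *t b) *m rten f c = rten (a *m f) (b *m c).
Proof.
apply/matrixP=> i j; case: (mxtens_indexP i) => i1 i2.
rewrite !mxE mxtens_indexK /= sum_mxtens big_distrl /=.
apply: eq_bigr => k _; rewrite big_distrr /=; apply: eq_bigr => l _.
by rewrite tensmxE !mxE mxtens_indexK /= mulrACA.
Qed.

Lemma mul_tens_lten m n p m' p' (a : 'M[F]_(p', p)) (b : 'M[F]_(m', m))
    (c : 'M[F]_(p, 1)) (f : 'M[F]_(m, n)) :
  (a *t b) *m lten c f = lten (a *m c) (b *m f).
Proof.
apply/matrixP=> i j; case: (mxtens_indexP i) => i1 i2.
rewrite !mxE mxtens_indexK /= sum_mxtens big_distrl /=.
apply: eq_bigr => k _; rewrite big_distrr /=; apply: eq_bigr => l _.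
by rewrite tensmxE !mxE mxtens_indexK /= mulrACA.
Qed.

Lemma rten_mul m n n' p (f : 'M[F]_(m, n)) (c : 'M[F]_(p, 1))
    (g : 'M[F]_(n, n')) : rten f c *m g = rten (f *m g) c.
Proof.
apply/matrixP=> i j; rewrite !mxE big_distrl /=.
by apply: eq_bigr => k _; rewrite !mxE mulrAC.
Qed.

Lemma lten_mul m n n' p (c : 'M[F]_(p, 1)) (f : 'M[F]_(m, n))
    (g : 'M[F]_(n, n')) : lten c f *m g = lten c (f *m g).
Proof.
apply/matrixP=> i j; rewrite !mxE big_distrr /=.
by apply: eq_bigr => k _; rewrite !mxE mulrA.
Qed.

Lemma rten0m m n p (c : 'M[F]_(p, 1)) : rten (0 : 'M_(m, n)) c = 0.
Proof. by apply/matrixP=> i j; rewrite !mxE mul0r. Qed.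

Lemma rtenm0 m n p (f : 'M[F]_(m, n)) : rten f (0 : 'M_(p, 1)) = 0.
Proof. by apply/matrixP=> i j; rewrite !mxE mulr0. Qed.

Lemma lten0m m n p (f : 'M[F]_(m, n)) : lten (0 : 'M_(p, 1)) f = 0.
Proof. by apply/matrixP=> i j; rewrite !mxE mul0r. Qed.

Lemma rten_tens m p (a : 'M[F]_(m, 1)) (c : 'M[F]_(p, 1)) : rten a c = a *t c.
Proof.
apply/matrixP=> i j; by rewrite !mxE !ord1.
Qed.

Lemma lten_tens m p (a : 'M[F]_(m, 1)) (c : 'M[F]_(p, 1)) : lten c a = c *t a.
Proof.
apply/matrixP=> i j; by rewrite !mxE !ord1.
Qed.

Lemma lten_cast m n p (c : 'M[F]_(p, 1)) (f : 'M[F]_(m, n)) :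
  castmx (erefl _, mul1n n) (c *t f) = lten c f.
Proof.
apply/matrixP=> i j; rewrite castmxE /= cast_ord_id !mxE; congr (_ * _).
  by congr (c _ _); exact: ord1.
by congr (f _ _); apply: val_inj; rewrite /= modn_small.
Qed.

(** The isomorphism N -> N (x) k, undoing the identification built into [rten]. *)
Definition rtenV n : 'M[F]_(n, n * 1) :=
  \matrix_(i, j) (i == (mxtens_unindex j).1)%:R.

Definition ltenV n : 'M[F]_(n, 1 * n) :=
  \matrix_(i, j) (i == (mxtens_unindex j).2)%:R.

Lemma rtenVE m n p (f : 'M[F]_(m, n)) (c : 'M[F]_(p, 1)) :
  rten f c *m rtenV n = f *t c.
Proof.
apply/matrixP=> i j; rewrite !mxE (bigD1 (mxtens_unindex j).1) //= !mxE eqxx.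
rewrite mulr1 big1 ?addr0 => [|k /negPf Dk]; last by rewrite !mxE Dk mulr0.
by congr (_ * c _ _); apply: esym; exact: ord1.
Qed.

Lemma ltenVE m n p (c : 'M[F]_(p, 1)) (f : 'M[F]_(m, n)) :
  lten c f *m ltenV n = c *t f.
Proof.
apply/matrixP=> i j; rewrite !mxE (bigD1 (mxtens_unindex j).2) //= !mxE eqxx.
rewrite mulr1 big1 ?addr0 => [|k /negPf Dk]; last by rewrite !mxE Dk mulr0.
by congr (c _ _ * _); apply: esym; exact: ord1.
Qed.

Lemma row_full_tens m n p q (A : 'M[F]_(m, n)) (B : 'M[F]_(p, q)) :
  row_full A -> row_full B -> row_full (A *t B).
Proof.
move=> /row_fullP[A' A'K] /row_fullP[B' B'K]; apply/row_fullP.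
by exists (A' *t B'); rewrite tensmx_mul A'K B'K tens1mx.
Qed.

Lemma row_free_tens m n p q (A : 'M[F]_(m, n)) (B : 'M[F]_(p, q)) :
  row_free A -> row_free B -> row_free (A *t B).
Proof.
move=> /row_freeP[A' A'K] /row_freeP[B' B'K]; apply/row_freeP.
by exists (A' *t B'); rewrite tensmx_mul A'K B'K tens1mx.
Qed.

Lemma row_full_lten m n p (c : 'M[F]_(p, 1)) (f : 'M[F]_(m, n)) :
  row_full c -> row_full f -> row_full (lten c f).
Proof.
move=> /row_fullP[c' c'K] /row_fullP[f' f'K]; apply/row_fullP.
exists (ltenV n *m (c' *t f')); rewrite -mulmxA mul_tens_lten c'K f'K.
apply/matrixP=> i j; rewrite !mxE sum_mxtens big_ord1 /= (bigD1 i) //= big1.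
  by rewrite !mxE mxtens_indexK /= eqxx !mul1r addr0.
by move=> k /negPf Dk; rewrite !mxE mxtens_indexK /= eq_sym Dk mul0r.
Qed.

Lemma row_full_rten m n p (f : 'M[F]_(m, n)) (c : 'M[F]_(p, 1)) :
  row_full f -> row_full c -> row_full (rten f c).
Proof.
move=> /row_fullP[f' f'K] /row_fullP[c' c'K]; apply/row_fullP.
exists (rtenV n *m (f' *t c')); rewrite -mulmxA mul_tens_rten c'K f'K.
apply/matrixP=> i j; rewrite !mxE sum_mxtens.
under eq_bigr do rewrite big_ord1; rewrite (bigD1 i) //= big1.
  by rewrite addr0 !mxE mxtens_indexK /= eqxx mul1r mulr1.
by move=> k /negPf Dk; rewrite !mxE mxtens_indexK /= eq_sym Dk mul0r.
Qed.

(** The rows of [A *m pinvmx A - 1%:M] lie in the kernel of [A], where [f] vanishes. *)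
Lemma mulmx_pinvK m n p (A : 'M[F]_(m, n)) (f : 'M[F]_(m, p)) :
  kermx A *m f = 0 -> A *m (pinvmx A *m f) = f.
Proof.
move=> kerAf; apply/eqP; rewrite mulmxA -subr_eq0 -{2}[f]mul1mx -mulmxBl.
have /submxP[x ->] : (A *m pinvmx A - 1%:M <= kermx A)%MS.
  by apply/sub_kermxP; rewrite mulmxBl mul1mx mulmxKpV ?subrr.
by rewrite -mulmxA kerAf mulmx0.
Qed.

(* A linear contracting homotopy; in contrast to the equality of an image and a
   kernel it is visibly preserved by tensor products. *)
Lemma exact_splitP l m n (A : 'M[F]_(l, m)) (B : 'M[F]_(m, n)) :
  reflect (A *m B = 0 /\ exists h h', h *m A + B *m h' = 1%:M)
          (A == kermx B)%MS.
Proof.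
apply: (iffP andP) => [[/sub_kermxP AB0 kerB]|[AB0 [h [h' hE]]]].
  split=> //; exists ((1%:M - B *m pinvmx B) *m pinvmx A), (pinvmx B).
  rewrite mulmxKpV ?subrK //; apply: submx_trans kerB; apply/sub_kermxP.
  by rewrite mulmxBl mul1mx mulmxKpV ?subrr.
split; first exact/sub_kermxP.
rewrite -[kermx B]mulmx1 -hE mulmxDr !mulmxA mulmx_ker mul0mx addr0.
exact: submxMl.
Qed.

Lemma exact_tens l m n p (A : 'M[F]_(l, m)) (B : 'M[F]_(m, n)) :
  (A == kermx B)%MS ->
  (A *t (1%:M : 'M_p) == kermx (B *t (1%:M : 'M_p)))%MS.
Proof.
case/exact_splitP=> AB0 [h [h' hE]]; apply/exact_splitP.
split; first by rewrite tensmx_mul AB0 tens0mx.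
exists (h *t 1%:M), (h' *t 1%:M).
by rewrite !tensmx_mul -tensmxDl hE !mulmx1 tens1mx.
Qed.

Lemma exact_lten l m p (A : 'M[F]_(l, m)) (c : 'M[F]_(m, 1)) :
  (A == kermx c)%MS ->
  (A *t (1%:M : 'M_p) == kermx (lten c (1%:M : 'M_p)))%MS.
Proof.
case/exact_splitP=> AB0 [h [h' hE]]; apply/exact_splitP.
split; first by rewrite mul_tens_lten AB0 lten0m.
exists (h *t 1%:M), (ltenV p *m (h' *t 1%:M)).
by rewrite mulmxA ltenVE !tensmx_mul -tensmxDl hE !mulmx1 tens1mx.
Qed.

Lemma exact_rten l m p (A : 'M[F]_(l, m)) (c : 'M[F]_(m, 1)) :
  (A == kermx c)%MS ->
  ((1%:M : 'M_p) *t A == kermx (rten (1%:M : 'M_p) c))%MS.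
Proof.
case/exact_splitP=> AB0 [h [h' hE]]; apply/exact_splitP.
split; first by rewrite mul_tens_rten AB0 rtenm0.
exists (1%:M *t h), (rtenV p *m (1%:M *t h')).
rewrite mulmxA rtenVE !tensmx_mul.
have -> : forall x y : 'M[F]_m, (1%:M *m 1%:M : 'M_p) *t x
    + (1%:M *m 1%:M : 'M_p) *t y = 1%:M *t (x + y).
  by move=> x y; apply/matrixP=> i j; rewrite !mulmx1 !mxE mulrDr.
by rewrite hE tens1mx.
Qed.

(** This lift, like the extension in [exact_ext], is only linear; the transfer makes both
    equivariant later. *)
Lemma exact_lift l m n p (A : 'M[F]_(l, m)) (B : 'M[F]_(m, n))
    (f : 'M[F]_(p, m)) :
  (A == kermx B)%MS -> f *m B = 0 -> f *m pinvmx A *m A = f.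
Proof.
case/andP=> _ kerB fB; apply: mulmxKpV; apply: submx_trans kerB.
exact/sub_kermxP.
Qed.

Lemma exact_ext l m n p (A : 'M[F]_(l, m)) (B : 'M[F]_(m, n))
    (f : 'M[F]_(m, p)) :
  (A == kermx B)%MS -> A *m f = 0 -> B *m (pinvmx B *m f) = f.
Proof.
case/andP=> _ /submxP[x kerB] fB; apply: mulmx_pinvK.
by rewrite kerB -mulmxA fB mulmx0.
Qed.

End Tensor.

(** * Exchange of tensor factors *)

Lemma mul_swapmx m n p (X : 'M['F_2]_(n * m, p)) a b j :
  (swapmx m n *m X) (mxtens_index (a, b)) j = X (mxtens_index (b, a)) j.
Proof.
rewrite !mxE (bigD1 (mxtens_index (b, a))) //= !mxE !mxtens_indexK /= !eqxx.
rewrite mul1r big1 ?addr0 // => k; case: (mxtens_indexP k) => c d.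
rewrite (can_eq (@mxtens_indexK _ _)) xpair_eqE !mxE !mxtens_indexK /=.
by rewrite (eq_sym b) (eq_sym a) andbC => /negPf->; rewrite mul0r.
Qed.

Lemma swap_rten m n p (f : 'M['F_2]_(m, n)) (c : 'M['F_2]_(p, 1)) :
  swapmx p m *m rten f c = lten c f.
Proof.
apply/matrixP=> i j; case: (mxtens_indexP i) => i1 i2.
by rewrite mul_swapmx !mxE !mxtens_indexK mulrC.
Qed.

Lemma swap_lten m n p (f : 'M['F_2]_(m, n)) (c : 'M['F_2]_(p, 1)) :
  swapmx m p *m lten c f = rten f c.
Proof.
apply/matrixP=> i j; case: (mxtens_indexP i) => i1 i2.
by rewrite mul_swapmx !mxE !mxtens_indexK mulrC.
Qed.

Lemma swap_tens m n p q (A : 'M['F_2]_(m, n)) (B : 'M['F_2]_(p, q)) :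
  swapmx p m *m (A *t B) = (B *t A) *m swapmx q n.
Proof.
apply/matrixP=> i j; case: (mxtens_indexP i) => i1 i2.
case: (mxtens_indexP j) => j1 j2.
rewrite mul_swapmx tensmxE !mxE (bigD1 (mxtens_index (j2, j1))) //=.
rewrite tensmxE !mxE !mxtens_indexK /= !eqxx mulr1 big1 ?addr0 1?mulrC // => k.
case: (mxtens_indexP k) => c d.
rewrite (can_eq (@mxtens_indexK _ _)) xpair_eqE !mxE !mxtens_indexK /=.
by move=> /negPf->; rewrite mulr0.
Qed.

(** * Projective modules and the transfer *)

Section Homs.

Variables (gT : finGroupType) (G : {group gT}).
Local Notation kGmod := (mx_representation 'F_2 G).

Section Basic.

Variables (m n p q : nat).
Variables (rM : kGmod m) (rN : kGmod n) (rP : kGmod p) (rQ : kGmod q).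

Lemma kG_hom1 : kG_hom rM rM 1%:M.
Proof. by move=> g _; rewrite mulmx1 mul1mx. Qed.

Lemma kG_hom_mul (f : 'M_(m, n)) (h : 'M_(n, p)) :
  kG_hom rM rN f -> kG_hom rN rP h -> kG_hom rM rP (f *m h).
Proof. by move=> Hf Hh g Gg; rewrite mulmxA Hf // -!mulmxA Hh. Qed.

Lemma kG_homD (f h : 'M_(m, n)) :
  kG_hom rM rN f -> kG_hom rM rN h -> kG_hom rM rN (f + h).
Proof. by move=> Hf Hh g Gg; rewrite mulmxDr mulmxDl Hf ?Hh. Qed.

Lemma kG_hom_tens (f : 'M_(m, n)) (h : 'M_(p, q)) :
  kG_hom rM rN f -> kG_hom rP rQ h ->
  kG_hom (tens_repr rM rP) (tens_repr rN rQ) (f *t h).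
Proof. by move=> Hf Hh g Gg /=; rewrite !tensmx_mul Hf ?Hh. Qed.

Lemma kG_hom_rten (f : 'M_(m, n)) (c : 'M_(p, 1)) :
  kG_hom rM rN f -> kG_hom rP (triv_repr G) c ->
  kG_hom (tens_repr rM rP) rN (rten f c).
Proof.
by move=> Hf Hc g Gg /=; rewrite mul_tens_rten rten_mul Hf // Hc ?mulmx1.
Qed.

Lemma kG_hom_lten (c : 'M_(p, 1)) (f : 'M_(m, n)) :
  kG_hom rP (triv_repr G) c -> kG_hom rM rN f ->
  kG_hom (tens_repr rP rM) rN (lten c f).
Proof.
by move=> Hc Hf g Gg /=; rewrite mul_tens_lten lten_mul Hf // Hc ?mulmx1.
Qed.

Lemma kG_hom_swap : kG_hom (tens_repr rM rN) (tens_repr rN rM) (swapmx m n).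
Proof. by move=> g _ /=; rewrite -swap_tens. Qed.

Lemma kG_hom_epi (e : 'M_(m, n)) (f : 'M_(n, p)) :
  kG_hom rM rN e -> row_full e -> kG_hom rM rP (e *m f) -> kG_hom rN rP f.
Proof.
move=> He fe Hef g Gg; apply: (row_full_inj fe).
by rewrite !mulmxA -He // -[in LHS]mulmxA Hef.
Qed.

Lemma kG_hom_mono (f : 'M_(m, n)) (e : 'M_(n, p)) :
  kG_hom rN rP e -> row_free e -> kG_hom rM rP (f *m e) -> kG_hom rM rN f.
Proof.
move=> He fe Hfe g Gg; apply: (row_free_inj fe).
by rewrite /= -!mulmxA Hfe // He // mulmxA.
Qed.

End Basic.

(** The trace map from Hom_k to Hom_kG. *)
Definition transfer m n (rM : kGmod m) (rN : kGmod n) (f : 'M['F_2]_(m, n)) :=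
  \sum_(g in G) rM g^-1%g *m f *m rN g.

Lemma kG_hom_transfer m n (rM : kGmod m) (rN : kGmod n) f :
  kG_hom rM rN (transfer rM rN f).
Proof.
move=> h Gh; rewrite /transfer mulmx_sumr mulmx_suml.
rewrite (reindex_inj (mulIg h)) /=; apply: eq_big => g.
  by rewrite groupMr.
rewrite groupMr // => Gg; rewrite invMg !repr_mxM ?groupV // !mulmxA.
by rewrite -repr_mxM ?groupV // mulgV repr_mx1 mul1mx.
Qed.

Lemma transfer_mul m n p (rM : kGmod m) (rN : kGmod n) (rP : kGmod p) f h :
  kG_hom rN rP h -> transfer rM rN f *m h = transfer rM rP (f *m h).
Proof.
move=> Hh; rewrite /transfer mulmx_suml; apply: eq_bigr => g Gg.
by rewrite -!mulmxA Hh.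
Qed.

Lemma mul_transfer m n p (rM : kGmod m) (rN : kGmod n) (rP : kGmod p) f h :
  kG_hom rM rN h -> h *m transfer rN rP f = transfer rM rP (h *m f).
Proof.
move=> Hh; rewrite /transfer mulmx_sumr; apply: eq_bigr => g Gg.
by rewrite !mulmxA Hh ?groupV.
Qed.

Lemma transfer_tens1 m n (rM : kGmod m) (rN : kGmod n) f :
  transfer (tens_repr rM rN) (tens_repr rM rN) (f *t 1%:M)
  = transfer rM rM f *t 1%:M.
Proof.
have -> : transfer rM rM f *t 1%:M
    = \sum_(g in G) ((rM g^-1%g *m f *m rM g) *t (1%:M : 'M_n)).
  apply: (big_morph (fun x : 'M_m => x *t (1%:M : 'M_n))) => [x y|].
    exact: tensmxDl.
  by apply: tens0mx.
apply: eq_bigr => g Gg /=; rewrite !tensmx_mul mulmx1.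
by rewrite -repr_mxM ?groupV // mulVg repr_mx1.
Qed.

(** The matrix unit projects kG onto the line of 1. Its conjugate by [g] projects onto the line of
    [g], and these projections add up to the identity. *)
Lemma transfer_regular :
  let rR := regular_repr 'F_2 G in
  transfer rR rR (delta_mx (gring_index G 1) (gring_index G 1)) = 1%:M.
Proof.
move=> rR; apply/row_matrixP=> i; rewrite /transfer linear_sum /=.
have Gi := enum_valP i.
have rowE0 : forall g, g \in G ->
    row i (regular_mx 'F_2 G g^-1%g *m
           delta_mx (gring_index G 1) (gring_index G 1) *m regular_mx 'F_2 G g)
    = (if g == enum_val i then row i 1%:M else 0).
  move=> g Gg; rewrite !row_mul rowK mul_delta_mx_cond.
  case: (g =P enum_val i) => [->|ne].
    by rewrite mulgV eqxx mulr1n -rowE rowK gring_indexK //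
      mul1g gring_valK row1.
  case: eqP => [/(congr1 enum_val)|_]; last by rewrite mulr0n mul0mx.
  rewrite !gring_indexK ?groupM ?groupV // => /eqP.
  by rewrite -eq_mulgV1 => /eqP e; case: ne.
rewrite (eq_bigr _ rowE0) (bigD1 (enum_val i)) //= eqxx.
by rewrite big1 ?addr0 // => g /andP[_ /negPf->].
Qed.

(* Higman's criterion.  It makes projectivity visibly self-dual and stable
   under tensor products. *)
Lemma projective_transfer m (rP : kGmod m) :
  projective rP -> exists al, transfer rP rP al = 1%:M.
Proof.
move=> projP; pose rR := regular_repr 'F_2 G.
(* The augmentation of kG. Tensored with P it is a surjection kG (x) P -> P, which splits because P
   is projective. *)
pose e : 'M['F_2]_(#|G|, 1) := const_mx 1.
have He : kG_hom rR (triv_repr G) e.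
  move=> g Gg /=; rewrite mulmx1; apply/row_matrixP=> i.
  by rewrite row_mul rowK -rowE !row_const.
have fe : row_full e.
  apply/row_fullP; exists (delta_mx 0 (gring_index G 1)).
  by rewrite -rowE; apply/matrixP=> i j; rewrite !mxE !ord1.
have f1 : row_full (1%:M : 'M['F_2]_m) by rewrite row_full_unit unitmx1.
have [s Hs sK] := projP _ _ (tens_repr rR rP) rP (lten e 1%:M) 1%:M
  (kG_hom_lten He (kG_hom1 rP)) (row_full_lten fe f1) (kG_hom1 rP).
pose E : 'M['F_2]_(#|G|) := delta_mx (gring_index G 1) (gring_index G 1).
(* The transfer passes through the equivariant outer factors and turns [E *t 1%:M] into the
   identity, leaving the splitting identity. *)
exists (s *m ((E *t 1%:M) *m lten e 1%:M)).
rewrite -(mul_transfer _ _ Hs)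
  -(transfer_mul _ _ (kG_hom_lten He (kG_hom1 rP))).
by rewrite transfer_tens1 transfer_regular tens1mx mul1mx.
Qed.

(** Writing Tr for the transfer, Tr(al f0) is equivariant, and Tr(al f0) e = Tr(al f0 e) = Tr(al) f0
    e = f0 e. *)
Lemma transfer_lift m n p (rP : kGmod m) (rM : kGmod n) (rN : kGmod p) al
    (e : 'M_(n, p)) (f0 : 'M_(m, n)) :
  transfer rP rP al = 1%:M -> kG_hom rM rN e -> kG_hom rP rN (f0 *m e) ->
  exists2 f, kG_hom rP rM f & f *m e = f0 *m e.
Proof.
move=> alE He Hf; exists (transfer rP rM (al *m f0)).
  exact: kG_hom_transfer.
by rewrite (transfer_mul _ _ He) -mulmxA -(transfer_mul _ _ Hf) alE mul1mx.
Qed.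

(** The dual computation with Tr(f0 al): it makes projective modules behave as injective ones. *)
Lemma transfer_ext m n p (rM : kGmod m) (rN : kGmod n) (rP : kGmod p) al
    (i : 'M_(m, n)) (f0 : 'M_(n, p)) :
  transfer rP rP al = 1%:M -> kG_hom rM rN i -> kG_hom rM rP (i *m f0) ->
  exists2 f, kG_hom rN rP f & i *m f = i *m f0.
Proof.
move=> alE Hi Hf; exists (transfer rN rP (f0 *m al)).
  exact: kG_hom_transfer.
by rewrite (mul_transfer _ _ Hi) mulmxA -(mul_transfer _ _ Hf) alE mulmx1.
Qed.

(** If [al] has transfer 1, so has [al *t 1%:M], and this corrects any linear lift along a
    surjection. *)
Lemma projective_tens m n (rP : kGmod m) (rM : kGmod n) :
  projective rP -> projective (tens_repr rP rM).
Proof.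
move=> /projective_transfer[al alE] n1 n2 rN1 rN2 p f Hp fp Hf.
have fE : f *m pinvmx p *m p = f by apply: mulmxKpV; apply: submx_full.
have al1 : transfer (tens_repr rP rM) (tens_repr rP rM) (al *t 1%:M) = 1%:M.
  by rewrite transfer_tens1 alE tens1mx.
by rewrite -fE; apply: transfer_lift al1 Hp _; rewrite fE.
Qed.

Lemma projective_lift l m n p (rP : kGmod p) (rL : kGmod l) (rM : kGmod m)
    (A : 'M_(l, m)) (B : 'M_(m, n)) (f : 'M_(p, m)) :
  projective rP -> kG_hom rL rM A -> (A == kermx B)%MS ->
  kG_hom rP rM f -> f *m B = 0 ->
  exists2 h, kG_hom rP rL h & h *m A = f.
Proof.
move=> /projective_transfer[al alE] HA exAB Hf fB.
have fE := exact_lift exAB fB.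
by rewrite -fE; apply: transfer_lift alE HA _; rewrite fE.
Qed.

(** As [f] kills the kernel of [B], it is defined on the image of [B]; P, being injective as well,
    extends it to all of N. *)
Lemma projective_ext l m n p (rP : kGmod p) (rM : kGmod m) (rN : kGmod n)
    (A : 'M_(l, m)) (B : 'M_(m, n)) (f : 'M_(m, p)) :
  projective rP -> kG_hom rM rN B -> (A == kermx B)%MS ->
  kG_hom rM rP f -> A *m f = 0 ->
  exists2 h, kG_hom rN rP h & B *m h = f.
Proof.
move=> /projective_transfer[al alE] HB exAB Hf Af.
have fE := exact_ext exAB Af.
by rewrite -fE; apply: transfer_ext alE HB _; rewrite fE.
Qed.

End Homs.

(** Induction for complexes unbounded on both sides: projectivity will supply the steps up,
    injectivity the steps down. *)
Lemma int_ind_updown (Q : int -> Prop) :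
  Q 0 -> (forall i, Q i -> Q (i + 1)) -> (forall i, Q (i + 1) -> Q i) ->
  forall i, Q i.
Proof.
move=> Q0 Qup Qdown; elim/int_rect=> // n IHn.
  by rewrite intS addrC; apply: Qup.
by apply: Qdown; rewrite intS opprD addrAC addNr add0r.
Qed.

(** * Acyclic complexes of projectives *)

Section Complexes.

Variables (gT : finGroupType) (G : {group gT}).
Local Notation kGmod := (mx_representation 'F_2 G).

(** Common framework for P and P (x) M. Exactness takes equations between indices, so that
    [j - 1 + 1] can stand for [j] without casts. *)
Record acyclic_complex := AcyclicComplex {
  ac_dim : int -> nat;
  ac_mod : forall i, kGmod (ac_dim i);
  ac_d : forall i j, 'M['F_2]_(ac_dim i, ac_dim j);
  ac_hom : forall i j, kG_hom (ac_mod i) (ac_mod j) (ac_d i j);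
  ac_proj : forall i, projective (ac_mod i);
  ac_exact : forall i j k, i = j + 1 -> j = k + 1 ->
    (ac_d i j == kermx (ac_d j k))%MS
}.

Arguments ac_proj a i [n1 n2 rM rN p f] _ _ _.

Lemma ac_dd (X : acyclic_complex) i j k : i = j + 1 -> j = k + 1 ->
  ac_d X i j *m ac_d X j k = 0.
Proof. by move=> ij jk; apply/sub_kermxP; case/andP: (ac_exact X ij jk). Qed.

Lemma cr_acyclic (P : complete_resolution G) i j k : i = j + 1 -> j = k + 1 ->
  (cr_d P i j == kermx (cr_d P j k))%MS.
Proof. by move=> -> ->; have := cr_exact P (k + 1); rewrite addrK. Qed.

Definition ac_res (P : complete_resolution G) : acyclic_complex :=
  AcyclicComplex (@cr_d_hom _ _ P) (@cr_proj _ _ P) (@cr_acyclic P).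

Section TensorComplex.

Variables (X : acyclic_complex) (m : nat) (rM : kGmod m).

Definition ac_tens_mod i := tens_repr (ac_mod X i) rM.
Definition ac_tens_d i j := ac_d X i j *t (1%:M : 'M['F_2]_m).

Lemma ac_tens_hom i j :
  kG_hom (ac_tens_mod i) (ac_tens_mod j) (ac_tens_d i j).
Proof. exact: kG_hom_tens (ac_hom _ _ _) (kG_hom1 _). Qed.

Lemma ac_tens_proj i : projective (ac_tens_mod i).
Proof. by apply: projective_tens; apply: ac_proj. Qed.

Lemma ac_tens_exact i j k : i = j + 1 -> j = k + 1 ->
  (ac_tens_d i j == kermx (ac_tens_d j k))%MS.
Proof. by move=> ij jk; apply: exact_tens (ac_exact X ij jk). Qed.

Definition ac_tens : acyclic_complex :=
  AcyclicComplex ac_tens_hom ac_tens_proj ac_tens_exact.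

End TensorComplex.

Variables (X Y : acyclic_complex).
Local Notation X_ := (ac_dim X).
Local Notation Y_ := (ac_dim Y).
Local Notation mX := (ac_mod X).
Local Notation mY := (ac_mod Y).
Local Notation dX := (ac_d X).
Local Notation dY := (ac_d Y).

(* For f inducing a map coker (X_(i+1) -> X_i) -> coker (Y_(j+1) -> Y_j), this
   says that the induced map is stably zero. *)
Definition nullhomotopic i j (f : 'M['F_2]_(X_ i, Y_ j)) : Prop :=
  exists i' j' (h : 'M_(X_ i', Y_ j)) (h' : 'M_(X_ i, Y_ j')),
    [/\ i = i' + 1, j' = j + 1, kG_hom (mX i') (mY j) h,
        kG_hom (mX i) (mY j') h'
      & f = dX i i' *m h + h' *m dY j' j].

(** If f = d h + h' d, then f1 + d h' takes values in the cycles of Y and lifts through the next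
    differential. *)
Lemma nullhomotopic_up i j i1 j1 (f : 'M_(X_ i, Y_ j))
    (f1 : 'M_(X_ i1, Y_ j1)) :
  i1 = i + 1 -> j1 = j + 1 -> kG_hom (mX i1) (mY j1) f1 ->
  dX i1 i *m f = f1 *m dY j1 j -> nullhomotopic f -> nullhomotopic f1.
Proof.
move=> Di1 Dj1 Hf1 ff1 [i' [j' [h [h' [Di Dj' Hh Hh' fE]]]]].
rewrite -Dj1 in Dj'; rewrite {}Dj' {j'} in h' Hh' fE.
have [h2 Hh2 h2E] : exists2 h2, kG_hom (mX i1) (mY (j1 + 1)) h2
    & h2 *m dY (j1 + 1) j1 = f1 + dX i1 i *m h'.
  apply: (projective_lift (ac_proj X i1) (ac_hom Y (j1 + 1) j1)
    (ac_exact Y (erefl (j1 + 1)) Dj1)).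
    by apply: kG_homD => //; apply: kG_hom_mul Hh'; apply: ac_hom.
  rewrite mulmxDl -ff1 fE mulmxDr !mulmxA (ac_dd X Di1 Di) mul0mx add0r.
  exact: addmm2.
exists i, (j1 + 1), h', h2; split=> //.
by rewrite h2E addrCA addmm2 addr0.
Qed.

(** If f1 = d h + h' d, then f + h d vanishes on the boundaries of X and extends along the next
    differential, [Y_ j] being injective. *)
Lemma nullhomotopic_down i j i1 j1 (f : 'M_(X_ i, Y_ j))
    (f1 : 'M_(X_ i1, Y_ j1)) :
  i1 = i + 1 -> j1 = j + 1 -> kG_hom (mX i) (mY j) f ->
  dX i1 i *m f = f1 *m dY j1 j -> nullhomotopic f1 -> nullhomotopic f.
Proof.
move=> Di1 Dj1 Hf ff1 [i' [j' [h [h' [Di Dj' Hh Hh' fE]]]]].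
have {Di} Di' : i' = i by apply: (addIr 1); rewrite -Di.
rewrite {}Di' {i'} in h Hh fE.
have Di : i = i - 1 + 1 by rewrite subrK.
have [h2 Hh2 h2E] : exists2 h2, kG_hom (mX (i - 1)) (mY j) h2
    & dX i (i - 1) *m h2 = f + h *m dY j1 j.
  apply: (projective_ext (ac_proj Y j) (ac_hom X i (i - 1))
    (ac_exact X Di1 Di)).
    by apply: kG_homD => //; apply: kG_hom_mul Hh _; apply: ac_hom.
  rewrite mulmxDr ff1 fE mulmxDl -!mulmxA (ac_dd Y Dj' Dj1) mulmx0 addr0.
  exact: addmm2.
exists (i - 1), j1, h2, h; split=> //.
by rewrite h2E -addrA addmm2 addr0.
Qed.

(** The condition d f d = 0 says that [f] carries boundaries to boundaries, that is, induces a map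
    of syzygies. This is what one step of the comparison needs, upwards here and downwards in
    [comparison_down]. *)
Lemma comparison_up i j i' j' i1 j1 (f : 'M_(X_ i, Y_ j)) :
  i1 = i + 1 -> j1 = j + 1 -> j = j' + 1 -> i = i' + 1 ->
  kG_hom (mX i) (mY j) f -> dX i1 i *m f *m dY j j' = 0 ->
  exists2 f1, kG_hom (mX i1) (mY j1) f1 & dX i1 i *m f = f1 *m dY j1 j.
Proof.
move=> Di1 Dj1 Dj Di Hf dfd.
have [f1 Hf1 f1E] := projective_lift (ac_proj X i1) (ac_hom Y j1 j)
  (ac_exact Y Dj1 Dj) (kG_hom_mul (ac_hom X i1 i) Hf) dfd.
by exists f1.
Qed.

Lemma comparison_down i j i' j' i1 (f : 'M_(X_ i, Y_ j)) :
  i1 = i + 1 -> i = i' + 1 ->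
  kG_hom (mX i) (mY j) f -> dX i1 i *m f *m dY j j' = 0 ->
  exists2 f', kG_hom (mX i') (mY j') f' & dX i i' *m f' = f *m dY j j'.
Proof.
move=> Di1 Di Hf dfd.
apply: (projective_ext (ac_proj Y j') (ac_hom X i i') (ac_exact X Di1 Di)).
  exact: kG_hom_mul Hf (ac_hom Y j j').
by rewrite mulmxA.
Qed.

End Complexes.

Arguments ac_proj [gT G] a i [n1 n2 rM rN p f] _ _ _.
Arguments nullhomotopic_up [gT G] X Y [i j i1 j1 f f1] _ _ _ _ _.
Arguments nullhomotopic_down [gT G] X Y [i j i1 j1 f f1] _ _ _ _ _.
Arguments comparison_up [gT G] X Y [i j i' j' i1 j1 f] _ _ _ _ _ _.
Arguments comparison_down [gT G] X Y [i j i' j' i1 f] _ _ _ _.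

Arguments cr_proj [gT G] c i [n1 n2 rM rN p f] _ _ _.

(** * Diagonal approximations *)

Section Diagonal.

Variables (gT : finGroupType) (G : {group gT}) (P : complete_resolution G).
Local Notation dimP := (cr_dim P).
Local Notation modP := (cr_mod P).
Local Notation d := (cr_d P).
Local Notation eps := (cr_eps P).
Local Notation cP := (ac_res P).

Lemma cr_dd i j k : i = j + 1 -> j = k + 1 -> d i j *m d j k = 0.
Proof. exact: (ac_dd cP). Qed.

Lemma cr_eps_hom : kG_hom (modP 0) (triv_repr G) eps.
Proof. by case: (cr_eps_coker P). Qed.

Lemma cr_eps_full : row_full eps.
Proof. by case: (cr_eps_coker P). Qed.

Lemma cr_eps_exact : (d 1 0 == kermx eps)%MS.
Proof. by case: (cr_eps_coker P) => _ _; rewrite andbC. Qed.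

Lemma cr_d_eps : d 1 0 *m eps = 0.
Proof. by case/andP: cr_eps_exact => /sub_kermxP. Qed.

Lemma delta2E (f : hom2 P) i1 i s1 s t1 t :
  i1 = i + 1 -> s1 = s + 1 -> t1 = t + 1 ->
  delta2 f i1 s t = f i1 s1 t *m (d s1 s *t 1%:M)
    + f i1 s t1 *m (1%:M *t d t1 t) + d i1 i *m f i s t.
Proof.
by move=> Di -> ->; rewrite /delta2; have -> : i1 - 1 = i by rewrite Di addrK.
Qed.

Variables (D : hom2 P) (HD : is_diagonal D).

Lemma diagonal_hom i s t :
  kG_hom (modP i) (tens_repr (modP s) (modP t)) (D i s t).
Proof. by case: HD => [[[_ HDhom] _ _ _] _]; apply: HDhom. Qed.

Lemma diagonal_chain i1 i s1 s t1 t :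
  i1 = i + 1 -> s1 = s + 1 -> t1 = t + 1 ->
  d i1 i *m D i s t = D i1 s1 t *m (d s1 s *t 1%:M)
    + D i1 s t1 *m (1%:M *t d t1 t).
Proof.
move=> Di Ds Dt; case: HD => [[_ _ cD _] _].
have := cD erefl i1 s t; rewrite (delta2E _ Di Ds Dt) => /eqP.
by rewrite addr_eq0 oppmm2 => /eqP.
Qed.

Lemma diagonal_eps : D 0 0 0 *m (eps *t eps) = eps.
Proof. by case: HD => _; rewrite /augments_to scale1r. Qed.

(** * Slant products with cocycles, and the counit *)

Section Slant.

Variables (e : int) (m : nat) (w : 'M['F_2]_(dimP e, m)).
Hypothesis dw : d (e + 1) e *m w = 0.

(** The condition on [w] kills the second half of the tensor differential, so the slant is a chain
    map lowering degrees by [e]. *)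
Lemma diagonal_chain_tens i1 i j1 j : i1 = i + 1 -> j1 = j + 1 ->
  d i1 i *m (D i j e *m (1%:M *t w))
  = D i1 j1 e *m (1%:M *t w) *m (d j1 j *t 1%:M).
Proof.
move=> Di Dj; rewrite mulmxA (diagonal_chain Di Dj (erefl (e + 1))).
rewrite mulmxDl -!mulmxA !tensmx_mul dw tensmx0 mulmx0 addr0.
by rewrite !mul1mx !mulmx1.
Qed.

End Slant.

Section RightSlant.

Variables (e : int) (y : 'M['F_2]_(dimP e, 1)).
Hypothesis cy : tate_cocycle y.

(** The chain endomorphism of P, lowering degrees by [e], that represents the class of [y]. *)
Definition slant i j := D i j e *m rten (1%:M : 'M_(dimP j)) y.

Lemma slant_hom i j : kG_hom (modP i) (modP j) (slant i j).
Proof.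
case: cy => Hy _; apply: kG_hom_mul (diagonal_hom i j e) _.
exact: kG_hom_rten (kG_hom1 _) Hy.
Qed.

Lemma slant_chain i1 i j1 j : i1 = i + 1 -> j1 = j + 1 ->
  d i1 i *m slant i j = slant i1 j1 *m d j1 j.
Proof.
case: cy => _ dy Di Dj; rewrite mulmxA (diagonal_chain Di Dj (erefl (e + 1))).
rewrite mulmxDl -!mulmxA !mul_tens_rten rten_mul dy rtenm0 mulmx0 addr0.
by rewrite !mul1mx !mulmx1.
Qed.

End RightSlant.

Definition counit_l i := D i 0 i *m lten eps (1%:M : 'M_(dimP i)).

Lemma counit_l_hom i : kG_hom (modP i) (modP i) (counit_l i).
Proof.
apply: kG_hom_mul (diagonal_hom i 0 i) _.
exact: kG_hom_lten cr_eps_hom (kG_hom1 _).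
Qed.

Lemma counit_l_chain i1 i : i1 = i + 1 ->
  d i1 i *m counit_l i = counit_l i1 *m d i1 i.
Proof.
move=> Di; rewrite mulmxA (@diagonal_chain _ _ 1 0 _ _ Di erefl Di).
rewrite mulmxDl -!mulmxA !mul_tens_lten lten_mul cr_d_eps lten0m mulmx0 add0r.
by rewrite !mul1mx !mulmx1.
Qed.

(** Both chain maps cover the identity of k. In degree 0 their difference therefore lands in the
    kernel of [eps], the image of [d 1 0]; the homotopy then spreads in both directions. *)
Lemma counit_l_homotopic i :
  nullhomotopic (X := cP) (Y := cP) (counit_l i + 1%:M).
Proof.
have hom1 j : kG_hom (modP j) (modP j) (counit_l j + 1%:M).
  by apply: kG_homD (kG_hom1 _); apply: counit_l_hom.
have link j : d (j + 1) j *m (counit_l j + 1%:M)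
    = (counit_l (j + 1) + 1%:M) *m d (j + 1) j.
  by rewrite mulmxDr mulmxDl mulmx1 mul1mx counit_l_chain.
elim/int_ind_updown: i => [|i|i].
- have counit_eps : (counit_l 0 + 1%:M) *m eps = 0.
    rewrite mulmxDl mul1mx -mulmxA lten_mul mul1mx lten_tens diagonal_eps.
    exact: addmm2.
  have [h Hh hE] := projective_lift (cr_proj P 0) (cr_d_hom P 1 0)
    cr_eps_exact (hom1 0) counit_eps.
  exists (-1), 1, 0, h; split=> //; last by rewrite mulmx0 add0r hE.
  by move=> g _; rewrite mulmx0 mul0mx.
- by apply: (nullhomotopic_up cP cP _ _ _ (link i)) => //; apply: hom1.
- by apply: (nullhomotopic_down cP cP _ _ _ (link i)) => //; apply: hom1.
Qed.

(** Every stable map Omega^i k -> Omega^j k comes from a Tate class of degree i - j. For j = 0 the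
    class is [f *m eps]; for other j the map is shifted along the resolution, keeping the same
    class. *)
Lemma slant_surj e j i (f : 'M_(dimP i, dimP j)) :
  i = j + e -> kG_hom (modP i) (modP j) f ->
  d (i + 1) i *m f *m d j (j - 1) = 0 ->
  exists2 y : 'M_(dimP e, 1), tate_cocycle y
    & nullhomotopic (X := cP) (Y := cP) (f + slant y i j).
Proof.
elim/int_ind_updown: j i f => [|j IH|j IH] i f.
- rewrite add0r => Di; rewrite {}Di {i} in f * => Hf dfd.
  (* By exactness at degree 0, d f factors through [d 1 0], which [eps] kills. *)
  have dfe : d (e + 1) e *m f *m eps = 0.
    rewrite -(exact_lift (@cr_acyclic _ _ P 1 0 (0 - 1) erefl erefl) dfd).
    by rewrite -!mulmxA cr_d_eps !mulmx0.
  have cy : tate_cocycle (n := e) (f *m eps).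
    by split; [exact: kG_hom_mul Hf cr_eps_hom | rewrite mulmxA].
  exists (f *m eps) => //.
  have [i' [j' [h [h' [De Dj' Hh Hh' counitE]]]]] := counit_l_homotopic e.
  rewrite {}Dj' {j'} /= in h Hh h' Hh' counitE.
  (* After [eps], f and its slant differ by (counit + 1) f eps, which the counit homotopy reduces to
     d h f eps; the term d h f cancels it. *)
  have gE : (f + slant (f *m eps) e 0 + d e i' *m (h *m f)) *m eps = 0.
    rewrite !mulmxDl.
    have -> : slant (f *m eps) e 0 *m eps = counit_l e *m (f *m eps).
      by rewrite -!mulmxA rten_mul lten_mul !mul1mx rten_tens lten_tens.
    rewrite (addrC (f *m eps)) -{2}[f *m eps]mul1mx -mulmxDl.
    rewrite counitE mulmxDl -[h' *m _ *m _]mulmxA [d (e + 1) e *m _]mulmxA dfe.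
    by rewrite mulmx0 addr0 !mulmxA addmm2.
  have Hg : kG_hom (modP e) (modP 0)
      (f + slant (f *m eps) e 0 + d e i' *m (h *m f)).
    apply: kG_homD; first by apply: kG_homD => //; apply: slant_hom.
    by apply: kG_hom_mul (cr_d_hom P e i') _; apply: kG_hom_mul Hh Hf.
  have [h2 Hh2 h2E] := projective_lift (cr_proj P e) (cr_d_hom P 1 0)
    cr_eps_exact Hg gE.
  exists i', 1, (h *m f), h2; split=> //; first exact: kG_hom_mul Hh Hf.
  by rewrite /= h2E addrCA addmm2 addr0.
- rewrite addrAC => Di; subst i; rewrite addrK => Hf dfd.
  have [f0 Hf0 f0E] := comparison_down cP cP erefl erefl Hf dfd.
  rewrite /= in f0 Hf0 f0E.
  have df0d : d (j + e + 1) (j + e) *m f0 *m d j (j - 1) = 0.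
    by rewrite f0E -mulmxA cr_dd ?mulmx0 // subrK.
  have [y cy Ny] := IH _ f0 erefl Hf0 df0d.
  exists y => //; apply: (nullhomotopic_up cP cP _ _ _ _ Ny) => //=.
    by apply: kG_homD => //; apply: slant_hom.
  by rewrite mulmxDr mulmxDl f0E (slant_chain cy erefl (erefl (j + 1))).
- move=> Di Hf dfd.
  have Di' : i = i - 1 + 1 by rewrite subrK.
  have Dj' : j = j - 1 + 1 by rewrite subrK.
  have [f1 Hf1 f1E] := comparison_up cP cP erefl erefl Dj' Di' Hf dfd.
  rewrite /= in f1 Hf1 f1E.
  have Di1 : i + 1 = j + 1 + e by rewrite Di addrAC.
  have df1d : d (i + 1 + 1) (i + 1) *m f1 *m d (j + 1) (j + 1 - 1) = 0.
    by rewrite addrK -mulmxA -f1E mulmxA cr_dd ?mul0mx.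
  have [y cy Ny] := IH _ f1 Di1 Hf1 df1d.
  exists y => //; apply: (nullhomotopic_down cP cP _ _ _ _ Ny) => //=.
    by apply: kG_homD => //; apply: slant_hom.
  by rewrite mulmxDr mulmxDl f1E (slant_chain cy erefl (erefl (j + 1))).
Qed.

(** * Comparison of P with P (x) M *)

Section TensorSyzygy.

Variables (n : int) (o : nat) (rM : mx_representation 'F_2 G o).
Variables (q : 'M['F_2]_(dimP n, o)).
Hypothesis Hq : is_cokernel (modP n) rM (d (n + 1) n) q.
Local Notation cPM := (ac_tens cP rM).

Let q_hom : kG_hom (modP n) rM q. Proof. by case: Hq. Qed.

Let q_exact : (d (n + 1) n == kermx q)%MS.
Proof. by case: Hq => _ _; rewrite andbC. Qed.

Let dq : d (n + 1) n *m q = 0.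
Proof. by case/andP: q_exact => /sub_kermxP. Qed.

Definition to_tens i j := D i j n *m (1%:M *t q).

Lemma to_tens_hom i j : kG_hom (modP i) (ac_mod cPM j) (to_tens i j).
Proof.
apply: kG_hom_mul (diagonal_hom i j n) _.
exact: kG_hom_tens (kG_hom1 _) q_hom.
Qed.

(* P (x) M and P shifted by n are both complete resolutions of M, so to_tens has
   a homotopy right inverse. *)
Lemma to_tens_section j i : i = j + n ->
  exists s : 'M_(ac_dim cPM j, dimP i),
    [/\ kG_hom (ac_mod cPM j) (modP i) s,
        ac_d cPM (j + 1) j *m s *m d i (i - 1) = 0
      & nullhomotopic (X := cPM) (Y := cPM) (s *m to_tens i j + 1%:M)].
Proof.
have s1_hom i' j' (s : 'M_(ac_dim cPM j', dimP i')) :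
    kG_hom (ac_mod cPM j') (modP i') s ->
    kG_hom (ac_mod cPM j') (ac_mod cPM j') (s *m to_tens i' j' + 1%:M).
  move=> Hs; apply: kG_homD (kG_hom1 _).
  by apply: kG_hom_mul Hs _; apply: to_tens_hom.
have link i1 i' j1 j' (s1 : 'M_(ac_dim cPM j1, dimP i1)) s :
    i1 = i' + 1 -> j1 = j' + 1 ->
    ac_d cPM j1 j' *m s = s1 *m d i1 i' ->
    ac_d cPM j1 j' *m (s *m to_tens i' j' + 1%:M)
    = (s1 *m to_tens i1 j1 + 1%:M) *m ac_d cPM j1 j'.
  move=> Di1 Dj1 sE; rewrite mulmxDr mulmxDl mulmx1 mul1mx mulmxA sE.
  congr (_ + _); rewrite -[LHS]mulmxA -[RHS]mulmxA; congr (_ *m _).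
  exact: (diagonal_chain_tens dq Di1 Dj1).
elim/int_ind_updown: j i => [|j IH|j IH] i.
- rewrite add0r => Di; subst i.
  have [_ q_full _] := Hq.
  have id_full : row_full (1%:M : 'M['F_2]_o) by rewrite row_full_unit unitmx1.
  pose e1 := lten eps (1%:M : 'M_o).
  have He1 : kG_hom (ac_mod cPM 0) rM e1.
    exact: kG_hom_lten cr_eps_hom (kG_hom1 _).
  have e1_full : row_full e1 by apply: row_full_lten cr_eps_full id_full.
  have e1_exact : (ac_d cPM 1 0 == kermx e1)%MS.
    by apply: exact_lten; apply: cr_eps_exact.
  (* In degree 0 the inverse lifts the augmentation P_0 (x) M -> M through q : P_n -> M. *)
  have [s Hs sE] := ac_proj cPM 0 q_hom q_full He1.
  have Dn : n = n - 1 + 1 by rewrite subrK.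
  have dsd : ac_d cPM (0 + 1) 0 *m s *m d n (n - 1) = 0.
    have dsq : ac_d cPM (0 + 1) 0 *m s *m q = 0.
      by rewrite -mulmxA sE; case/andP: e1_exact => /sub_kermxP.
    rewrite -(exact_lift q_exact dsq) -[LHS]mulmxA.
    by rewrite cr_dd ?mulmx0.
  exists s; split=> //.
  have [i' [j' [h [h' [De Dj' Hh Hh' counitE]]]]] := counit_l_homotopic n.
  rewrite {}Dj' {j'} /= in h Hh h' Hh' counitE.
  (* After [e1] the error s to_tens + 1 becomes s (counit + 1) q = s d h q. Moving s across d by
     [s'] and lifting h q through [e1] by [t] gives the correction d s' t. *)
  have [s' Hs' s'E] : exists2 s', kG_hom (ac_mod cPM (0 - 1)) (modP i') s'
      & ac_d cPM 0 (0 - 1) *m s' = s *m d n i'.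
    have Di' : i' = n - 1 by rewrite De addrK.
    subst i'.
    exact: (comparison_down cPM cP (i' := 0 - 1) erefl erefl Hs dsd).
  have [t Ht tE] : exists2 t, kG_hom (modP i') (ac_mod cPM 0) t
      & t *m e1 = h *m q.
    exact: (cr_proj P i' He1 e1_full (kG_hom_mul Hh q_hom)).
  pose f := s *m to_tens n 0 + 1%:M + ac_d cPM 0 (0 - 1) *m (s' *m t).
  have fe1 : f *m e1 = 0.
    have toE : to_tens n 0 *m e1 = counit_l n *m q.
      by rewrite -!mulmxA mul_tens_lten lten_mul !mul1mx mulmx1.
    rewrite !mulmxDl mul1mx -[_ *m to_tens n 0 *m _]mulmxA toE.
    rewrite -{1}sE -mulmxDr -{2}[q]mul1mx -mulmxDl counitE.
    rewrite mulmxDl -(mulmxA h') dq mulmx0 addr0 -!mulmxA tE.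
    by rewrite [ac_d _ _ _ *m _]mulmxA s'E -!mulmxA addmm2.
  have Hf : kG_hom (ac_mod cPM 0) (ac_mod cPM 0) f.
    apply: kG_homD; first exact: s1_hom.
    apply: kG_hom_mul (ac_hom _ _ _) _; exact: kG_hom_mul Hs' Ht.
  have [t' Ht' t'E] := projective_lift (ac_proj cPM 0) (ac_hom cPM 1 0)
    e1_exact Hf fe1.
  exists (0 - 1), 1, (s' *m t), t'; split=> //; first exact: kG_hom_mul Hs' Ht.
  by rewrite t'E addrCA addmm2 addr0.
- rewrite addrAC => Di; subst i; rewrite addrK.
  have [s [Hs dsd Ns]] := IH _ erefl.
  have Dj : j = j - 1 + 1 by rewrite subrK.
  have Di : j + n = j + n - 1 + 1 by rewrite subrK.
  have [s1 Hs1 s1E] := comparison_up cPM cP erefl erefl Di Dj Hs dsd.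
  exists s1; split=> //; first by rewrite -mulmxA -s1E mulmxA ac_dd ?mul0mx.
  exact: (nullhomotopic_up cPM cPM erefl erefl (s1_hom _ _ _ Hs1)
    (link _ _ _ _ _ _ erefl erefl s1E) Ns).
- move=> Di; have Di1 : i + 1 = j + 1 + n by rewrite Di addrAC.
  have [s1 [Hs1 ds1d Ns1]] := IH _ Di1; rewrite addrK in ds1d.
  have [s Hs sE] := comparison_down cPM cP erefl erefl Hs1 ds1d.
  exists s; split=> //; first by rewrite sE -mulmxA cr_dd ?mulmx0 // subrK.
  exact: (nullhomotopic_down cPM cPM erefl erefl (s1_hom _ _ _ Hs)
    (link _ _ _ _ _ _ erefl erefl sE) Ns1).
Qed.

(** Pulling back along [to_tens] detects coboundaries: g is s to_tens g up to a coboundary, and s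
    to_tens g = s d w = d s' w. *)
Lemma to_tens_ext j i j' i' p (rN : mx_representation 'F_2 G p)
    (g : 'M_(ac_dim cPM j, p)) (w : 'M_(dimP i', p)) :
  i = j + n -> i = i' + 1 -> j = j' + 1 ->
  kG_hom (ac_mod cPM j) rN g -> kG_hom (modP i') rN w ->
  ac_d cPM (j + 1) j *m g = 0 -> to_tens i j *m g = d i i' *m w ->
  exists2 w', kG_hom (ac_mod cPM j') rN w' & g = ac_d cPM j j' *m w'.
Proof.
move=> Di Di' Dj' Hg Hw dg toE.
have [s [Hs dsd Ns]] := to_tens_section Di.
have [k [l [h [h' [Dk Dl Hh Hh' sE]]]]] := Ns.
have Dkj' : k = j' by apply: (addIr 1); rewrite -Dk.
subst k l.
have [s' Hs' s'E] : exists2 s', kG_hom (ac_mod cPM j') (modP i') s'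
    & ac_d cPM j j' *m s' = s *m d i i'.
  have Di1 : i - 1 = i' by rewrite Di' addrK.
  subst i'; exact: (comparison_down cPM cP erefl Dj' Hs dsd).
exists (s' *m w + h *m g).
  by apply: kG_homD; [exact: kG_hom_mul Hs' Hw | exact: kG_hom_mul Hh Hg].
have gE : s *m to_tens i j *m g + g = ac_d cPM j j' *m h *m g.
  rewrite -{2}[g]mul1mx -mulmxDl sE mulmxDl -[h' *m _ *m _]mulmxA dg mulmx0.
  by rewrite addr0.
rewrite mulmxDr !mulmxA s'E -[s *m _ *m w]mulmxA -toE mulmxA -gE.
by rewrite addrA addmm2 add0r.
Qed.

End TensorSyzygy.

End Diagonal.

(** * Productive classes *)

Section Productive.

Variables (gT : finGroupType) (G : {group gT}).
Variables (o : nat) (rM : mx_representation 'F_2 G o).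
Variables (zeta : 'M['F_2]_(o, 1)).
Hypothesis zeta_hom : kG_hom rM (triv_repr G) zeta.
Hypothesis zeta_surj : row_full zeta.
Variables (l : nat) (rL : mx_representation 'F_2 G l) (iota : 'M['F_2]_(l, o)).
Hypothesis Hiota : is_kernel rL rM zeta iota.

Let iota_hom : kG_hom rL rM iota. Proof. by case: Hiota. Qed.
Let iota_free : row_free iota. Proof. by case: Hiota. Qed.
Let iota_exact : (iota == kermx zeta)%MS. Proof. by case: Hiota. Qed.
Let iota_zeta : iota *m zeta = 0.
Proof. by case/andP: iota_exact => /sub_kermxP. Qed.

Lemma kernel_lift m (rN : mx_representation 'F_2 G m) (f : 'M_(m, o)) :
  kG_hom rN rM f -> f *m zeta = 0 ->
  exists2 h, kG_hom rN rL h & h *m iota = f.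
Proof.
move=> Hf fz; have fE := exact_lift iota_exact fz.
exists (f *m pinvmx iota) => //.
by apply: kG_hom_mono iota_hom iota_free _; rewrite fE.
Qed.

(* Restricted to M (x) L, the difference b is zeta (x) id_L. *)
Lemma zeta_difference :
  exists2 b, kG_hom (tens_repr rM rM) rL b
    & b *m iota = lten zeta 1%:M + rten 1%:M zeta.
Proof.
apply: kernel_lift.
  apply: kG_homD; [apply: kG_hom_lten | apply: kG_hom_rten] => //.
    exact: kG_hom1.
  exact: kG_hom1.
by rewrite mulmxDl rten_mul lten_mul !mul1mx rten_tens lten_tens addmm2.
Qed.

(** One direction restricts b to M (x) L. For the other, the map from M (x) L to the projective
    extends to M (x) M by injectivity. The remainder of b vanishes on M (x) L, so it is id (x) zeta
    followed by a map M -> L. *)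
Lemma productive_difference b :
  kG_hom (tens_repr rM rM) rL b ->
  b *m iota = lten zeta 1%:M + rten 1%:M zeta ->
  productive rM rL zeta <-> stably_zero (tens_repr rM rM) rL b.
Proof.
move=> Hb bE; rewrite /productive lten_cast.
have Hi : kG_hom (tens_repr rM rL) (tens_repr rM rM) (1%:M *t iota).
  exact: kG_hom_tens (kG_hom1 _) iota_hom.
have b_res : (1%:M *t iota) *m b = lten zeta 1%:M.
  apply: (row_free_inj iota_free).
  rewrite /= -mulmxA bE mulmxDr mul_tens_lten mul_tens_rten iota_zeta rtenm0.
  by rewrite addr0 lten_mul !mul1mx mulmx1.
have i_exact : ((1%:M : 'M_o) *t iota == kermx (rten (1%:M : 'M_o) zeta))%MS.
  exact: exact_rten iota_exact.
have Hz : kG_hom (tens_repr rM rM) rM (rten 1%:M zeta).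
  by apply: kG_hom_rten => //; apply: kG_hom1.
split=> -[p [rP [u [v [projP Hu Hv uv]]]]]; last first.
  exists p, rP, ((1%:M *t iota) *m u), v; split=> //.
    exact: kG_hom_mul Hi Hu.
  by rewrite -mulmxA uv.
have [al alE] := projective_transfer projP.
have [i' i'K] : exists i', ((1%:M : 'M_o) *t iota) *m i' = 1%:M.
  by apply/row_freeP; apply: row_free_tens => //; rewrite row_free_unit unitmx1.
have [u' Hu' u'E] : exists2 u', kG_hom (tens_repr rM rM) rP u'
    & (1%:M *t iota) *m u' = u.
  have uE : (1%:M *t iota) *m (i' *m u) = u by rewrite mulmxA i'K mul1mx.
  by rewrite -uE; apply: transfer_ext alE Hi _; rewrite uE.
pose c := b + u' *m v.
have Hc : kG_hom (tens_repr rM rM) rL c.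
  by apply: kG_homD => //; apply: kG_hom_mul Hu' Hv.
have ic : (1%:M *t iota) *m c = 0.
  by rewrite mulmxDr b_res mulmxA u'E uv addmm2.
have cE := exact_ext i_exact ic.
set be := pinvmx _ *m c in cE.
have Hbe : kG_hom rM rL be.
  apply: kG_hom_epi Hz _ _; last by rewrite cE.
  by apply: row_full_rten => //; rewrite row_full_unit unitmx1.
(* c = (be (x) id) (id_L (x) zeta), and id_L (x) zeta is stably zero because it
   is zeta (x) id_L up to the twist. *)
have c_fact : c = (be *t 1%:M) *m (swapmx l o *m u) *m v.
  rewrite -cE rten_mul mul1mx -!mulmxA uv swap_lten mul_tens_rten.
  by rewrite mulmx1 mul1mx.
exists p, rP, (u' + (be *t 1%:M) *m (swapmx l o *m u)), v; split=> //.
  apply: kG_homD => //; apply: kG_hom_mul (kG_hom_tens Hbe (kG_hom1 _)) _.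
  by apply: kG_hom_mul Hu; apply: kG_hom_swap.
by rewrite mulmxDl -c_fact /c addrCA addmm2 addr0.
Qed.

End Productive.

(** * Divisibility as a lifting problem along zeta *)

Section Divisibility.

Variables (gT : finGroupType) (G : {group gT}) (P : complete_resolution G).
Local Notation dimP := (cr_dim P).
Local Notation modP := (cr_mod P).
Local Notation d := (cr_d P).
Local Notation cP := (ac_res P).

Variables (n : int) (o : nat) (rM : mx_representation 'F_2 G o).
Variables (q : 'M['F_2]_(dimP n, o)).
Hypothesis Hq : is_cokernel (modP n) rM (d (n + 1) n) q.
Variable zeta : 'M['F_2]_(o, 1).
Hypothesis zeta_hom : kG_hom rM (triv_repr G) zeta.
Hypothesis zeta_surj : row_full zeta.

Let q_hom : kG_hom (modP n) rM q. Proof. by case: Hq. Qed.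
Let q_full : row_full q. Proof. by case: Hq. Qed.
Let q_exact : (d (n + 1) n == kermx q)%MS.
Proof. by case: Hq => _ _; rewrite andbC. Qed.
Let dq : d (n + 1) n *m q = 0.
Proof. by case/andP: q_exact => /sub_kermxP. Qed.

Local Notation a := (q *m zeta).

Let a_hom : kG_hom (modP n) (triv_repr G) a.
Proof. exact: kG_hom_mul q_hom zeta_hom. Qed.

(** Multiples of zeta are the classes of composites Omega^r k -> M -> k ending in zeta, because
    [slant_surj] realises maps Omega^r k -> M by Tate classes. *)
Lemma tate_divides_lift (D : hom2 P) (HD : is_diagonal D) r
    (x : 'M['F_2]_(dimP r, 1)) :
  tate_divides D a x <->
  exists y : 'M_(dimP r, o),
    [/\ kG_hom (modP r) rM y, d (r + 1) r *m y = 0 & y *m zeta = x].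
Proof.
have Dr : r = n + (r - n) by rewrite addrC subrK.
have Dr1 : r = r - 1 + 1 by rewrite subrK.
split=> [[y [Hy dy] [c Hc xE]]|[y [Hy dy yz]]].
  (* The bounding cochain lifts through zeta too, so the equation with [x] holds on cocycles and not
     only on classes. *)
  have [c' Hc' c'E] := cr_proj P (r - 1) zeta_hom zeta_surj Hc.
  exists (D r n (r - n) *m rten q y + d r (r - 1) *m c'); split.
  - apply: kG_homD; last exact: kG_hom_mul (cr_d_hom P _ _) Hc'.
    apply: kG_hom_mul (diagonal_hom HD _ _ _) _.
    exact: kG_hom_rten q_hom Hy.
  - rewrite mulmxDr !mulmxA cr_dd // mul0mx addr0.
    rewrite (diagonal_chain HD erefl (erefl (n + 1)) (erefl (r - n + 1))).
    rewrite mulmxDl -!mulmxA !mul_tens_rten dq dy rten0m rtenm0 !mulmx0.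
    exact: addr0.
  - rewrite mulmxDl -!mulmxA rten_mul c'E rten_tens -xE addrC oppmm2 -addrA.
    by rewrite addmm2 addr0.
(* Lifting y through q : P_n -> M puts it in the form required by [slant_surj]. *)
have [f Hf fE] := cr_proj P r q_hom q_full Hy.
have dfd : d (r + 1) r *m f *m d n (n - 1) = 0.
  have Dn : n = n - 1 + 1 by rewrite subrK.
  have dfq : d (r + 1) r *m f *m q = 0 by rewrite -mulmxA fE.
  rewrite -(exact_lift q_exact dfq) -[LHS]mulmxA.
  by rewrite cr_dd ?mulmx0.
have [y' cy' [i' [j' [h [h' [Di Dj Hh Hh' fhE]]]]]] := slant_surj HD Dr Hf dfd.
have Di' : i' = r - 1 by rewrite Di addrK.
subst i' j'; rewrite /= in h Hh h' Hh' fhE.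
exists y' => //; exists (h *m a); first exact: kG_hom_mul Hh a_hom.
have -> : cup D r a y' = slant D y' r n *m a.
  by rewrite -mulmxA rten_mul mul1mx rten_tens.
rewrite oppmm2 -yz -fE -mulmxA -mulmxDl fhE mulmxDl -!mulmxA.
by rewrite [d (n + 1) n *m _]mulmxA dq mul0mx mulmx0 addr0.
Qed.

Variables (l : nat) (rL : mx_representation 'F_2 G l) (iota : 'M['F_2]_(l, o)).
Hypothesis Hiota : is_kernel rL rM zeta iota.

Variables (theta : nat -> hom2 P).
Hypothesis Htheta : is_theta theta.

Lemma theta0_diagonal : is_diagonal (theta 0%N).
Proof. by case: Htheta => H0 H1 _; split=> //; apply: (H0 0%N). Qed.

(** The pull-back x of b to P_(2n) satisfies x iota = d V, where V zeta is the cocycle for P_1.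
    Writing x = d w with w into L amounts to correcting V by w iota to a cocycle, which leaves V
    zeta unchanged. *)
Lemma difference_stably_zero r (b : 'M_(o * o, l)) :
  r + 1 = n + n ->
  kG_hom (tens_repr rM rM) rL b ->
  b *m iota = lten zeta 1%:M + rten 1%:M zeta ->
  stably_zero (tens_repr rM rM) rL b <->
  exists y : 'M_(dimP r, o),
    [/\ kG_hom (modP r) rM y, d (r + 1) r *m y = 0
      & y *m zeta = theta 1%N r n n *m (a *t a)].
Proof.
move=> Dr Hb bE; have [iota_hom iota_free iota_exact] := Hiota.
have HD := theta0_diagonal.
have [theta_C2 _ theta_d] := Htheta.
have theta1_hom :
    kG_hom (modP r) (tens_repr (modP n) (modP n)) (theta 1%N r n n).
  by case: (theta_C2 1%N) => [[_ H] _ _ _]; apply: H.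
pose x := theta 0%N (r + 1) n n *m (q *t q) *m b.
pose V := theta 1%N r n n *m rten q a.
have HV : kG_hom (modP r) rM V.
  by apply: kG_hom_mul theta1_hom _; apply: kG_hom_rten.
have Vz : V *m zeta = theta 1%N r n n *m (a *t a).
  by rewrite -mulmxA rten_mul rten_tens.
have Hqq : kG_hom (modP (r + 1)) (tens_repr rM rM)
    (theta 0%N (r + 1) n n *m (q *t q)).
  apply: kG_hom_mul (diagonal_hom HD _ _ _) _.
  exact: kG_hom_tens q_hom q_hom.
(* theta e_1 is a homotopy from theta e_0 to its twist, and the twist exchanges
   zeta (x) id and id (x) zeta: x is the image of P1 under the connecting map
   of L -> M -> k, with lift V. *)
have xE : x *m iota = d (r + 1) r *m V.
  rewrite -mulmxA bE mulmxDr -!mulmxA mul_tens_lten mul_tens_rten.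
  rewrite !mulmx1 -(swap_rten q a) mulmxA [LHS]addrC -mulmxDl.
  rewrite -[theta 0%N _ _ _ *m swapmx _ _]/(twist2 (theta 0%N) (r + 1) n n).
  rewrite -theta_d (delta2E _ erefl (erefl (n + 1)) (erefl (n + 1))).
  rewrite !mulmxDl -!mulmxA !mul_tens_rten (mulmxA (d _ _) q) dq.
  by rewrite mul0mx rten0m rtenm0 !mulmx0 !add0r.
split=> [[p [rP [u [v [projP Hu Hv uv]]]]]|[y [Hy dy yz]]].
  (* A cocycle with values in a projective, hence injective, module is a coboundary. *)
  have [w Hw wE] : exists2 w, kG_hom (modP r) rP w
      & d (r + 1) r *m w = theta 0%N (r + 1) n n *m (q *t q) *m u.
    apply: (projective_ext projP (cr_d_hom P _ _)
      (cr_acyclic P (erefl (r + 1 + 1)) (erefl (r + 1)))).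
      exact: kG_hom_mul Hqq Hu.
    rewrite mulmxA [X in X *m u](_ : _ = 0) ?mul0mx // mulmxA.
    rewrite (diagonal_chain HD erefl (erefl (n + 1)) (erefl (n + 1))).
    rewrite mulmxDl -!mulmxA !tensmx_mul dq tens0mx tensmx0 !mulmx0.
    exact: addr0.
  exists (V + w *m v *m iota); split.
  - apply: kG_homD => //; apply: kG_hom_mul iota_hom.
    exact: kG_hom_mul Hw Hv.
  - by rewrite mulmxDr -xE !mulmxA wE -[_ *m u *m v]mulmxA uv addmm2.
  - have /andP[/sub_kermxP iota_zeta _] := iota_exact.
    by rewrite mulmxDl Vz -[_ *m iota *m _]mulmxA iota_zeta mulmx0 addr0.
have [w Hw wE] : exists2 w, kG_hom (modP r) rL w & w *m iota = V + y.
  apply: (kernel_lift Hiota); first exact: kG_homD.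
  by rewrite mulmxDl Vz yz addmm2.
have xw : x = d (r + 1) r *m w.
  by apply: (row_free_inj iota_free); rewrite /= xE -mulmxA wE mulmxDr dy addr0.
have Hq1 : kG_hom (tens_repr (modP n) rM) (tens_repr rM rM) (q *t 1%:M).
  exact: kG_hom_tens q_hom (kG_hom1 _).
have q1_full : row_full (q *t (1%:M : 'M_o)).
  by apply: row_full_tens => //; rewrite row_full_unit unitmx1.
have Dn : n = n - 1 + 1 by rewrite subrK.
(* Seen on P_n (x) M through q (x) id, b is a cocycle whose pull-back along [to_tens] is the
   coboundary x, so it is itself a coboundary. *)
have [w' Hw' w'E] : exists2 w', kG_hom (ac_mod (ac_tens cP rM) (n - 1)) rL w'
    & (q *t 1%:M) *m b = ac_d (ac_tens cP rM) n (n - 1) *m w'.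
  apply: (to_tens_ext HD Hq Dr erefl Dn (kG_hom_mul Hq1 Hb) Hw).
    by rewrite mulmxA tensmx_mul dq tens0mx mul0mx.
  rewrite -xw mulmxA -[_ *m (q *t _)]mulmxA tensmx_mul mul1mx mulmx1.
  by [].
(* The differential factors through its syzygy as q followed by j : M -> P_(n-1). Thus b factors
   through P_(n-1) (x) M, which is projective. *)
have jE : q *m (pinvmx q *m d n (n - 1)) = d n (n - 1).
  by apply: exact_ext q_exact _; apply: cr_dd.
set j := pinvmx q *m _ in jE.
have Hj : kG_hom rM (modP (n - 1)) j.
  by apply: kG_hom_epi q_hom q_full _; rewrite jE; apply: cr_d_hom.
exists _, (ac_mod (ac_tens cP rM) (n - 1)), (j *t 1%:M), w'; split=> //.
- exact: ac_proj (ac_tens cP rM) (n - 1).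
- exact: kG_hom_tens Hj (kG_hom1 _).
- by apply: (row_full_inj q1_full); rewrite mulmxA tensmx_mul jE w'E mulmx1.
Qed.

End Divisibility.

Theorem theorem6p2 (gT : finGroupType) (G : {group gT})
    (P : complete_resolution G)
    (theta : nat -> hom2 P) (Htheta : is_theta theta)
    (Delta : hom2 P) (HDelta : is_diagonal Delta)
    (n : int)
    (o : nat) (Omega : mx_representation 'F_2 G o)
    (q : 'M['F_2]_(cr_dim P n, o))
    (Hq : is_cokernel (cr_mod P n) Omega (cr_d P (n + 1) n) q)
    (zeta : 'M['F_2]_(o, 1))
    (zeta_hom : kG_hom Omega (triv_repr G) zeta)
    (zeta_surj : row_full zeta)
    (l : nat) (L : mx_representation 'F_2 G l)
    (iota : 'M['F_2]_(l, o)) (Hiota : is_kernel L Omega zeta iota) :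
  productive Omega L zeta <->
  tate_divides Delta (q *m zeta) (P1op theta (q *m zeta)).
Proof.
have [b Hb bE] := zeta_difference zeta_hom Hiota.
have Dr : n - (1 - n) + 1 = n + n by rewrite opprB addrA subrK.
(* As (1 - n) + n = 1 for every n, the operation always uses theta e_1 and never the zero branch of
   [Qop]. *)
have P1E : P1op theta (q *m zeta)
    = theta 1%N (n - (1 - n)) n n *m ((q *m zeta) *t (q *m zeta)).
  by rewrite /P1op /Qop subrK.
apply: iff_trans (productive_difference zeta_hom zeta_surj Hiota Hb bE) _.
apply: iff_trans (difference_stably_zero Hq zeta_hom Hiota Htheta Dr Hb bE) _.
by rewrite P1E; apply: iff_sym; apply: tate_divides_lift.
Qed.
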